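(* Let $r\geq 1$ and consider the Lie algebra of type $A_r$. Let $\ell$ and $m_1,\dots,m_r$ be nonnegative integers with $\ell-\sum_{i=1}^r i\,m_i=0$, and set $\lambda=\ell\varpi_1$, $\mu=\sum_{i=1}^r m_i\varpi_i$. \begin{enumerate} \item If $m_j=0$ for all $3\le j\le r$, then $m_q(\lambda,\mu)=q^{m_2}$. \item If $m_j=0$ for all $4\le j\le r$ and $m_3\ne 0$, then $m_q(\lambda,\mu)=q^{m_2+3m_3}$. \item If $m_j=0$ for all $5\le j\le r$ and $m_4\neq 0$, then $m_q(\lambda,\mu)=q^{m_2+3m_3+6}$ when $m_4=1$, and $m_q(\lambda,\mu)=q^{m_2+3m_3+6m_4}$ when $m_4\ge 2$. \end{enumerate}
   Context: Type $A_r$: simple roots $\alpha_1,\dots,\alpha_r$; positive roots $\alpha_i+\cdots+\alpha_j$ ($1\le i\le j\le r$); fundamental weights $\varpi_i=\frac{r+1-i}{r+1}(\alpha_1+2\alpha_2+\cdots+(i-1)\alpha_{i-1})+\frac{i}{r+1}((r-i+1)\alpha_i+(r-i)\alpha_{i+1}+\cdots+\alpha_r)$; $\rho=\varpi_1+\cdots+\varpi_r$. $W$ is the Weyl group generated by simple reflections $s_1,\dots,s_r$, and $\mathrm{len}(\sigma)$ is the length of $\sigma\in W$. For a weight $\xi$, the $q$-analog of Kostant's partition function is $\wp_q(\xi)=\sum_{j\ge0}c_jq^j$, where $c_j$ is the number of ways to write $\xi$ as a nonnegative integral sum of exactly $j$ positive roots (counted with multiplicity). The $q$-multiplicity is $m_q(\lambda,\mu)=\sum_{\sigma\in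 W}(-1)^{\mathrm{len}(\sigma)}\wp_q(\sigma(\lambda+\rho)-(\mu+\rho))$. *)

(* Defs.v *)
From HB Require Import structures.
From mathcomp Require Import all_boot all_order all_algebra.
From mathcomp Require Import mathcomp_extra boolp classical_sets fsbigop.

Set Implicit Arguments.
Unset Strict Implicit.
Unset Printing Implicit Defensive.

Import Order.TTheory GRing.Theory Num.Theory.
Local Open Scope ring_scope.

(* Weights are column vectors of coordinates in the basis of simple roots.
   Indices are 0-based: i : 'I_r stands for the mathematical index i + 1, so
   [alpha i] is alpha_(i+1), [fund_weight i] is varpi_(i+1), etc. *)
Definition weight (r : nat) := 'cV[rat]_r.

Definition alpha (r : nat) (i : 'I_r) : weight r := delta_mx i 0.

(* The pair (i, j) with i <= j indexes alpha_i + ... + alpha_j. *)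
Definition pos_root (r : nat) := {p : 'I_r * 'I_r | (p.1 <= p.2)%N}.

Definition root_weight (r : nat) (b : pos_root r) : weight r :=
  \sum_(k < r | ((val b).1 <= k <= (val b).2)%N) alpha k.

Definition fund_weight (r : nat) (i : 'I_r) : weight r :=
  ((r - i)%:R / r.+1%:R) *: (\sum_(j < r | (j < i)%N) j.+1%:R *: alpha j)
  + (i.+1%:R / r.+1%:R) *: (\sum_(j < r | (i <= j)%N) (r - j)%:R *: alpha j).

Definition rho (r : nat) : weight r := \sum_(i < r) fund_weight i.

Definition cartan (r : nat) (i j : 'I_r) : rat :=
  if i == j then 2 else if (i.+1 == j) || (j.+1 == i) then -1 else 0.

(* Matrix, acting on the left, of the linear map
   alpha_j |-> alpha_j - cartan i j *: alpha_i. *)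
Definition simple_refl (r : nat) (i : 'I_r) : 'M[rat]_r :=
  \matrix_(k, j) ((k == j)%:R - (k == i)%:R * cartan i j).

Definition word_mx (r : nat) (w : seq 'I_r) : 'M[rat]_r :=
  \big[mulmx/1%:M]_(i <- w) simple_refl i.

(* Simple reflections are involutions, so the group they generate consists of
   the products of words in them. *)
Definition weyl (r : nat) : set 'M[rat]_r := range (@word_mx r).

Definition has_word (r : nat) (s : 'M[rat]_r) (n : nat) : bool :=
  [exists w : n.-tuple 'I_r, word_mx w == s].

(* Least size of a word for s; the value 0 outside the Weyl group is junk. *)
Definition len (r : nat) (s : 'M[rat]_r) : nat :=
  if pselect (exists n, has_word s n) is left h then ex_minn h else 0%N.

(* Ways to write xi as a sum of exactly n positive roots: f b is the
   multiplicity of b, which is at most n. *)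
Definition npartitions (r : nat) (xi : weight r) (n : nat) : nat :=
  #|[pred f : {ffun pos_root r -> 'I_n.+1} |
      ((\sum_b (f b : nat))%N == n)
      && (\sum_b root_weight b *+ (f b : nat) == xi)]|.

(* The sums over (_ \in _) below are finitely supported sums: npartitions xi n
   vanishes when n exceeds the sum of the coordinates of xi, and the Weyl group
   is finite. *)
Definition kostant_q (r : nat) (xi : weight r) : {poly int} :=
  \sum_(n \in @setT nat) ((npartitions xi n)%:Z *: 'X^n : {poly int}).

Definition mult_q (r : nat) (lambda mu : weight r) : {poly int} :=
  \sum_(s \in @weyl r)
    (-1) ^+ len s * kostant_q (s *m (lambda + rho r) - (mu + rho r)).

(* 1-based access to the family m_1, ..., m_r, extended by m_k = 0 for k > r;
   the extension matters only for m_2 when r = 1. *)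
Definition entry (r : nat) (m : 'I_r -> nat) (k : nat) : nat :=
  (\sum_(i < r | i.+1 == k) m i)%N.

(* Main.v *)
Require Import Defs.
From HB Require Import structures.
From mathcomp Require Import all_boot all_order all_algebra all_fingroup.
From mathcomp Require Import boolp classical_sets fsbigop.
From mathcomp Require Import ssrcomplements mpoly zify ring.

(** Write N = r + 1 and pass to the coordinates e_1, ..., e_N, so that W becomes
    S_N. For lambda = l varpi_1 the numerator sum_s sgn(s) x^(s(lambda + rho)) is
    the Weyl denominator times h_l(x), hence
      m_q(lambda, mu) = (prod_(i < j) (1 - R_ij) / (1 - q R_ij)) H (mu),
    where R_ij shifts the argument by e_i - e_j and H is the indicator of the
    vectors with nonnegative entries. Apply the operators for the pairs (i, j)
    with j increasing and, for fixed j, with i increasing. On nonnegative vectors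
    every intermediate function is q^(sum_k w_k mu_k) with w_i = w_j just before
    (i, j) is treated; the series of (1 - R_ij) / (1 - q R_ij) then telescopes,
    and w_j increases by 1. In the end w_j = j - 1, which gives
    m_q(lambda, mu) = q^(sum_i m_i binom(i, 2)) for all m_1, ..., m_r. *)

Set Implicit Arguments.
Unset Strict Implicit.
Unset Printing Implicit Defensive.

Import Order.TTheory GRing.Theory Num.Theory.
Local Open Scope ring_scope.

(** * Evaluating shift operators *)

Section ShiftEval.
Variables (A : comNzRingType) (r : nat) (V : zmodType).
Variables (al : 'I_r -> V) (f : V -> A).

Definition mnm_wt (m : 'X_{1..r}) : V := \sum_k al k *+ m k.

(* The value at v of p applied to f, the variable 'X_k acting on functions on V
   as the shift by al k. *)
Definition shift_eval (v : V) (p : {mpoly A[r]}) : A :=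
  \sum_(m <- msupp p) p@_m * f (v + mnm_wt m).

(** Supports change under addition; a common index set of all monomials of bounded size makes
    linearity a termwise statement. *)
Lemma shift_evalwE p v k : (msize p <= k)%N ->
  shift_eval v p = \sum_(m : 'X_{1..r < k}) p@_m * f (v + mnm_wt m).
Proof.
move=> le_pk; pose I : subFinType _ := 'X_{1..r < k}.
rewrite /shift_eval (big_mksub I) //=; first last.
- by move=> m /msize_mdeg_lt /leq_trans; apply.
- exact: msupp_uniq.
by rewrite big_rmcond //= => m /memN_msupp_eq0 ->; rewrite mul0r.
Qed.

Lemma shift_eval_is_linear v : linear_for *%R (shift_eval v).
Proof.
move=> c p q /=; pose k := maxn (msize (c *: p + q)) (maxn (msize p) (msize q)).
rewrite !(@shift_evalwE _ _ k) /k ?leq_max ?leqnn ?orbT//.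
rewrite big_distrr -big_split /=; apply: eq_bigr => m _.
by rewrite mcoeffD mcoeffZ mulrDl mulrA.
Qed.

HB.instance Definition _ v :=
  GRing.isLinear.Build A {mpoly A[r]} A *%R (shift_eval v)
    (shift_eval_is_linear v).

Lemma shift_evalB p q v : shift_eval v (p - q) = shift_eval v p - shift_eval v q.
Proof. exact: (raddfB (shift_eval v)). Qed.

Lemma shift_evalZ c p v : shift_eval v (c *: p) = c * shift_eval v p.
Proof. exact: (linearZ_LR (shift_eval v)). Qed.

Lemma shift_eval_sum I (s : seq I) P F v :
  shift_eval v (\sum_(i <- s | P i) F i) = \sum_(i <- s | P i) shift_eval v (F i).
Proof. exact: (raddf_sum (shift_eval v)). Qed.

Lemma mnm_wt0 : mnm_wt 0%MM = 0.
Proof. by rewrite /mnm_wt big1 // => k _; rewrite mnm0E. Qed.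

Lemma mnm_wtD m1 m2 : mnm_wt (m1 + m2)%MM = mnm_wt m1 + mnm_wt m2.
Proof. by rewrite -big_split /=; apply: eq_bigr => k _; rewrite mnmDE mulrnDr. Qed.

Lemma mnm_wtMn m n : mnm_wt (m *+ n)%MM = mnm_wt m *+ n.
Proof.
by rewrite /mnm_wt -sumrMnl; apply: eq_bigr => k _; rewrite mulmnE mulrnA.
Qed.

Lemma mnm_wt_sum I (s : seq I) P F :
  mnm_wt (\sum_(i <- s | P i) F i)%MM = \sum_(i <- s | P i) mnm_wt (F i).
Proof. by apply: (big_morph mnm_wt mnm_wtD mnm_wt0). Qed.

Lemma shift_evalX m v : shift_eval v 'X_[m] = f (v + mnm_wt m).
Proof. by rewrite /shift_eval msuppX big_seq1 mcoeffX eqxx mul1r. Qed.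

Lemma shift_eval1 v : shift_eval v 1 = f v.
Proof. by rewrite -mpolyX0 shift_evalX mnm_wt0 addr0. Qed.

(** Multiplying by a monomial translates the base point, so a product of operators can be evaluated
    one factor at a time. *)
Lemma shift_evalMX p m v :
  shift_eval v (p * 'X_[m]) = shift_eval (v + mnm_wt m) p.
Proof.
rewrite [p]mpolyE mulr_suml !shift_eval_sum; apply: eq_bigr => m' _.
by rewrite -scalerAl -mpolyXD !shift_evalZ !shift_evalX mnm_wtD addrCA addrC.
Qed.

End ShiftEval.

(** * The Weyl denominator *)

Section Denominator.
Variable r : nat.

(** Natural indices avoid casts in [evec k.+1]; the vector is 0 for i > r. *)
Definition evec (i : nat) : 'cV[int]_r.+1 := \col_j (j == i :> nat)%:R.

Definition alphaZ (k : 'I_r) : 'cV[int]_r.+1 := evec k - evec k.+1.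

Definition root_mnm (i j : nat) : 'X_{1..r} :=
  [multinom ((i <= k <= j)%N : nat) | k < r].

Lemma root_mnm_wt i j : (i <= j < r)%N ->
  mnm_wt alphaZ (root_mnm i j) = evec i - evec j.+1.
Proof.
case/andP=> le_ij lt_jr; rewrite /mnm_wt.
transitivity (\sum_(i <= k < j.+1) (evec k - evec k.+1)); last first.
  under eq_bigr do rewrite -opprB.
  by rewrite sumrN telescope_sumr ?opprB // ltnW.
rewrite (big_nat_widenl _ 0%N) // (big_nat_widen _ _ r) // big_mkord.
rewrite [RHS]big_mkcond; apply: eq_bigr => k _ /=.
by rewrite mnmE ltnS andbC; case: ifP.
Qed.

(** Exponents of e_i - e_r in the simple roots. Normalizing by e_r keeps them nonnegative, so
    polynomials suffice. *)
Definition tail_mnm (i : nat) : 'X_{1..r} := [multinom ((i <= k)%N : nat) | k < r].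

Lemma tail_mnm_wt i : (i <= r)%N ->
  mnm_wt alphaZ (tail_mnm i) = evec i - evec r.
Proof.
rewrite leq_eqVlt => /predU1P[->|lt_ir].
  rewrite subrr /mnm_wt big1 // => k _.
  by rewrite mnmE leqNgt ltn_ord mulr0n.
have r_gt0 : (0 < r)%N by lia.
rewrite -[in evec r](prednK r_gt0) -root_mnm_wt; last lia.
apply: eq_bigr => k _; rewrite !mnmE; congr (_ *+ nat_of_bool _).
by have := ltn_ord k; lia.
Qed.

Lemma tail_mnm_root i j : (i <= j)%N ->
  tail_mnm i = (tail_mnm j.+1 + root_mnm i j)%MM.
Proof. by move=> le_ij; apply/mnmP => k; rewrite mnmDE !mnmE; lia. Qed.

Lemma prod_root_pairs (R : comNzRingType) (F : nat -> nat -> R) :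
  \prod_(i < r.+1) \prod_(j < r.+1 | (i < j)%N) F i j =
  \prod_(j < r) \prod_(i < j.+1) F i j.+1.
Proof.
rewrite big_ord_recr /= [X in _ * X]big1 ?mulr1; last first.
  by move=> j; rewrite ltnNge -ltnS ltn_ord.
transitivity (\prod_(i < r) \prod_(j < r | (i <= j)%N) F i j.+1).
  apply: eq_bigr => i _; rewrite big_mkcond big_ord_recl /= mul1r.
  by rewrite [RHS]big_mkcond; apply: eq_bigr.
rewrite (exchange_big_dep predT) //=; apply: eq_bigr => j _.
by rewrite (big_ord_widen r (fun i => F i j.+1)) //.
Qed.

Definition root_poly (A : comNzRingType) i j : {mpoly A[r]} := 'X_[root_mnm i j].

Definition denominator (A : comNzRingType) : {mpoly A[r]} :=
  \prod_(j < r) \prod_(i < j.+1) (1 - root_poly A i j).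

(* This is the Vandermonde determinant in the x_i = e^(e_i - e_r), which are
   monomials in the e^(alpha_k). *)
Lemma vandermonde_denominator (A : comNzRingType) :
  \sum_(s : 'S_r.+1) (-1) ^+ s * \prod_(i < r.+1) 'X_[tail_mnm (s i)] ^+ i =
  denominator A * \prod_(j < r.+1) 'X_[tail_mnm j] ^+ j :> {mpoly A[r]}.
Proof.
pose x : 'rV[{mpoly A[r]}]_r.+1 := \row_i 'X_[tail_mnm i].
transitivity (\det (Vandermonde r.+1 x)).
  apply: eq_bigr => s _; congr (_ * _).
  by apply: eq_bigr => i _; rewrite !mxE.
rewrite det_Vandermonde.
under eq_bigr do under eq_bigr do rewrite !mxE.
rewrite (@prod_root_pairs _ (fun i j => 'X_[tail_mnm j] - 'X_[tail_mnm i])).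
rewrite big_ord_recl expr0 mul1r -big_split /=; apply: eq_bigr => j _.
(* The power of x_(j+1) is spread over the j + 1 pairs (i, j+1), since x_i = x_(j+1) e^(e_i -
   e_(j+1)). *)
have -> : 'X_[tail_mnm (bump 0 j)] ^+ bump 0 j =
    \prod_(i < j.+1) 'X_[tail_mnm j.+1] :> {mpoly A[r]}.
  by rewrite prodr_const card_ord.
rewrite -big_split /=; apply: eq_bigr => i _.
by rewrite (@tail_mnm_root i j) -1?ltnS // mpolyXD mulrBl mul1r [root_poly _ _ _ * _]mulrC.
Qed.

(** The Vandermonde identity, read as an identity of shift operators and applied to f. *)
Lemma denominator_formula (A : comNzRingType) (f : 'cV[int]_r.+1 -> A) v :
  \sum_(s : 'S_r.+1) (-1) ^+ s * f (v + \sum_(i < r.+1) evec (s i) *+ i) =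
  shift_eval alphaZ f (v + \sum_(j < r.+1) evec j *+ j) (denominator A).
Proof.
(* c collects the multiples of e_r subtracted in the exponents; evaluating at v + c restores
   them. *)
pose c : 'cV[int]_r.+1 := \sum_(i < r.+1) evec r *+ i.
have wtE (s : 'S_r.+1) : mnm_wt alphaZ (\sum_(i < r.+1) tail_mnm (s i) *+ i)%MM =
    \sum_(i < r.+1) evec (s i) *+ i - c.
  rewrite mnm_wt_sum -sumrB; apply: eq_bigr => i _.
  by rewrite mnm_wtMn tail_mnm_wt ?mulrnBl // -ltnS.
have prodE (s : 'S_r.+1) : \prod_(i < r.+1) 'X_[tail_mnm (s i)] ^+ i =
    'X_[\sum_(i < r.+1) tail_mnm (s i) *+ i] :> {mpoly A[r]}.
  rewrite (big_morph (mpolyX A) (@mpolyXD _ _) (@mpolyX0 _ _)).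
  by apply: eq_bigr => i _; rewrite mpolyXn.
have := congr1 (shift_eval alphaZ f (v + c)) (vandermonde_denominator A).
rewrite shift_eval_sum => E; transitivity (shift_eval alphaZ f (v + c)
  (denominator A * \prod_(j < r.+1) 'X_[tail_mnm j] ^+ j)).
  rewrite -{}E; apply: eq_bigr => s _; rewrite raddfMsign /=; congr (_ * _).
  by rewrite prodE shift_evalX wtE addrACA subrr addr0.
(* This monomial is the term of the identity permutation, so [prodE] and [wtE] apply again. *)
have -> : \prod_(j < r.+1) 'X_[tail_mnm j] ^+ j =
    \prod_(j < r.+1) 'X_[tail_mnm ((1 : 'S_r.+1)%g j)] ^+ j :> {mpoly A[r]}.
  by apply: eq_bigr => j _; rewrite perm1.
rewrite prodE shift_evalMX wtE addrACA subrr addr0; congr (shift_eval _ _ (_ + _) _).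
by apply: eq_bigr => j _; rewrite perm1.
Qed.

End Denominator.

(** * Telescoping *)

Section Telescope.
Variable r : nat.
Implicit Types (v : 'cV[int]_r.+1) (w : 'I_r.+1 -> nat).

Definition wdeg w v : nat := (\sum_l w l * `|v l 0%R|)%N.

Definition nneg_vec v := [forall i, 0 <= v i 0].

Lemma raiseE v (i j : nat) k l :
  (v + (evec r i - evec r j) *+ k) l 0 =
  v l 0 + ((l == i :> nat)%:R - (l == j :> nat)%:R) *+ k.
Proof. by rewrite mxE [X in _ + X]mulmxnE !mxE. Qed.

Lemma sum_raise v (i j : 'I_r.+1) k :
  \sum_l (v + (evec r i - evec r j) *+ k) l 0 = \sum_l v l 0.
Proof.
under eq_bigr do rewrite raiseE.
rewrite big_split /= sumrMnl sumrB -!natr_sum.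
have E (t : 'I_r.+1) : (\sum_(l < r.+1) (l == t :> nat))%N = 1%N.
  by rewrite -big_mkcond /= -[LHS]/(\sum_(l | l == t) 1)%N big_pred1_eq.
by rewrite !E subrr mul0rn addr0.
Qed.

Lemma le_sum_nneg v j : nneg_vec v -> v j 0 <= \sum_l v l 0.
Proof.
by move=> /forallP v0; rewrite (bigD1 j) //= lerDl sumr_ge0.
Qed.

(** Units move between two coordinates of equal weight; nonnegativity of both vectors removes the
    absolute values in [wdeg]. *)
Lemma wsum_raise w v (i j : 'I_r.+1) k : i != j -> w i = w j ->
  nneg_vec v -> nneg_vec (v + (evec r i - evec r j) *+ k) ->
  wdeg w (v + (evec r i - evec r j) *+ k) = wdeg w v.
Proof.
move=> nij wij /forallP v0 /forallP v1.
rewrite /wdeg (bigD1 i) // (bigD1 j) 1?eq_sym //= [RHS](bigD1 i) // (bigD1 j) 1?eq_sym //=.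
rewrite !addnA -wij -!mulnDr; congr (_ * _ + _)%N; last first.
  by apply: eq_bigr => l /andP[li lj]; rewrite raiseE !(inj_eq val_inj)
    (negPf li) (negPf lj) subrr mul0rn addr0.
have:= v0 i; have := v0 j; have := v1 i; have := v1 j.
rewrite !raiseE !(inj_eq val_inj) !eqxx [j == i]eq_sym (negPf nij) subr0 sub0r mulNrn.
by lia.
Qed.

(** Along v + k (e_i - e_j), F equals q^(wdeg w v) for k <= v_j and vanishes afterwards, so only k =
    v_j contributes, with an extra factor q^(v_j). As M exceeds the coordinate sum, hence v_j, this
    index is in range. *)
Lemma telescope_raise (F : 'cV[int]_r.+1 -> {poly int}) w (i j : 'I_r.+1) M :
  i != j -> w i = w j ->
  (forall v, v j 0 < 0 -> F v = 0) ->
  (forall v, nneg_vec v -> \sum_l v l 0 < M%:Z ->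
     F v = 'X^(wdeg w v)) ->
  forall v, nneg_vec v -> \sum_l v l 0 < M%:Z ->
  \sum_(k < M) 'X^k * (F (v + (evec r i - evec r j) *+ k) -
                       F (v + (evec r i - evec r j) *+ k.+1)) =
  'X^(wdeg (fun l => (w l + (l == j))%N) v).
Proof.
move=> nij wij Fneg Fpos v v0 vM.
set b := evec r i - evec r j.
have vj0 := forallP v0 j; have vjM := le_lt_trans (le_sum_nneg j v0) vM.
have ltcM : (`|v j 0%R|%N < M)%N by lia.
have FE k : F (v + b *+ k) =
    if (k <= `|v j 0%R|)%N then 'X^(wdeg w v) else 0.
  case: ifPn => [le_kc|gt_kc]; last first.
    apply: Fneg; rewrite raiseE eqxx (inj_eq val_inj) eq_sym (negPf nij).
    by rewrite sub0r mulNrn; lia.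
  have vk0 : nneg_vec (v + b *+ k).
    apply/forallP => l; rewrite raiseE; have := forallP v0 l.
    case: (eqVneq (l : nat) j) => [/val_inj ->|_]; last first.
      by rewrite subr0; case: (_ == _); rewrite ?mul0rn; lia.
    by rewrite (inj_eq val_inj) eq_sym (negPf nij) sub0r mulNrn; lia.
  by rewrite Fpos ?wsum_raise // sum_raise.
rewrite (bigD1 (Ordinal ltcM)) //= big1 ?addr0; last first.
  move=> k; rewrite -val_eqE /= => nkc; rewrite !FE.
  case: (ltngtP k `|v j 0%R|%N) nkc => // _ _; rewrite ?subrr ?mulr0 //.
rewrite !FE leqnn ltnn subr0 -exprD; congr ('X^_).
rewrite /wdeg; under [RHS]eq_bigr do rewrite mulnDl.
rewrite big_split /= addnC; congr (_ + _)%N.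
rewrite (bigD1 j) //= eqxx mul1n big1 ?addn0 // => l /negPf ->.
by rewrite mul0n.
Qed.

Definition nneg_ind v : {poly int} := (nneg_vec v)%:R.

(** The operator (1 - R) / (1 - q R) for the root e_i - e_(j+1), its geometric series cut off after
    M terms. *)
Definition root_factor M (i j : nat) : {mpoly {poly int}[r]} :=
  (1 - root_poly r {poly int} i j) *
  \sum_(k < M) 'X^k *: root_poly r {poly int} i j ^+ k.

Let phi := shift_eval (alphaZ (r := r)) nneg_ind.

Lemma shift_eval_root_factor M i j v p : (i <= j < r)%N ->
  phi v (p * root_factor M i j) =
  \sum_(k < M) 'X^k * (phi (v + (evec r i - evec r j.+1) *+ k) p -
                       phi (v + (evec r i - evec r j.+1) *+ k.+1) p).
Proof.
move=> ijr; rewrite /root_factor mulr_sumr mulr_sumr /phi shift_eval_sum.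
apply: eq_bigr => k _; rewrite -!scalerAr shift_evalZ mulrBl mul1r -exprS mulrBr.
by rewrite shift_evalB /root_poly !mpolyXn !shift_evalMX !mnm_wtMn root_mnm_wt.
Qed.

(* Invariant after the roots e_i - e_j with j <= t and those with j = t + 1 and
   i < s have been processed; coordinates are numbered from 0 to r. *)
Definition processed M (p : {mpoly {poly int}[r]}) (t s : nat) : Prop :=
  (forall v (j : 'I_r.+1), (t < j)%N -> v j 0 < 0 -> phi v p = 0) /\
  (forall v, nneg_vec v -> \sum_l v l 0 < M%:Z ->
   phi v p = 'X^(wdeg (fun l => if (l <= t)%N then l : nat
     else if l == t.+1 :> nat then s else 0%N) v)).

Lemma processed1 M : processed M 1 0 0.
Proof.
split=> [v j _ vj|v v0 _]; rewrite /phi shift_eval1 /nneg_ind.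
  by rewrite (_ : nneg_vec v = false) //; apply/forallP => /(_ j); rewrite leNgt vj.
rewrite v0 /wdeg big1 ?expr0 // => l _; rewrite if_same leqn0.
by case: eqP => [->|_].
Qed.

Lemma processed_next M p t : processed M p t t.+1 -> processed M p t.+1 0.
Proof.
case=> neg pos; split=> [v j tj|v v0 vM]; first by apply: neg; lia.
rewrite pos //; congr ('X^_); apply: eq_bigr => l _; congr (_ * _)%N.
by rewrite if_same; do !case: ifP; lia.
Qed.

Lemma processed_step M p t s : (s <= t < r)%N ->
  processed M p t s -> processed M (p * root_factor M s t) t s.+1.
Proof.
move=> str [neg pos]; have [lst ltr] := andP str.
have lsr : (s < r.+1)%N by lia.
split=> [v j tj vj|v v0 vM]; rewrite shift_eval_root_factor //.
  rewrite big1 // => k _.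
  (* The shift fixes or lowers coordinate j, as s <= t < j, so it stays negative. *)
  have vneg n : phi (v + (evec r s - evec r t.+1) *+ n) p = 0.
    apply: (neg _ j tj); rewrite raiseE.
    have -> : (j == s :> nat) = false by lia.
    by rewrite sub0r mulNrn; lia.
  by rewrite !vneg subrr mulr0.
pose j := Ordinal (ltr : (t.+1 < r.+1)%N).
have nsj : Ordinal lsr != j by rewrite -val_eqE /=; lia.
(* Both weights are s: that of coordinate s because s <= t, that of coordinate t + 1 because s roots
   have raised it. *)
rewrite (telescope_raise nsj _ (fun u => neg u j (ltnSn t)) pos v0 vM) /=; last first.
  by rewrite lst ltnn eqxx.
congr ('X^_); apply: eq_bigr => l _; congr (_ * _)%N; rewrite -val_eqE /=.
by do !case: ifP; lia.
Qed.

Lemma processed_all M :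
  processed M (\prod_(j < r) \prod_(i < j.+1) root_factor M i j) r 0.
Proof.
suff H t : (t <= r)%N ->
    processed M (\prod_(j < t) \prod_(i < j.+1) root_factor M i j) t 0 by exact: H.
elim: t => [_|t IHt ltr]; first by rewrite big_ord0; apply: processed1.
apply: processed_next; rewrite big_ord_recr /=.
suff H s : (s <= t.+1)%N -> processed M ((\prod_(j < t) \prod_(i < j.+1)
    root_factor M i j) * \prod_(i < s) root_factor M i t) t s by exact: H.
elim: s => [_|s IHs les]; first by rewrite big_ord0 mulr1; apply: IHt; lia.
by rewrite big_ord_recr mulrA; apply: processed_step; [rewrite -ltnS les|apply/IHs/ltnW].
Qed.

Lemma shift_eval_roots M v : nneg_vec v -> \sum_l v l 0 < M%:Z ->
  phi v (\prod_(j < r) \prod_(i < j.+1) root_factor M i j) =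
  'X^(wdeg val v).
Proof.
move=> v0 vM; have [_ ->//] := processed_all M.
by congr ('X^_); apply: eq_bigr => l _; rewrite -ltnS ltn_ord.
Qed.
End Telescope.

(** * The alternant of a one-row weight *)

Section SingleRowAlternant.
Variable r : nat.
Implicit Types nu : 'cV[int]_r.+1.

(* The coordinates of l varpi_1 + rho, up to a common additive constant. *)
Definition row_rho (l i : nat) : int := (r - i)%:Z + (if i == 0%N then l else 0%N)%:Z.

Lemma prodr_indicator (R : comNzRingType) (I : finType) (b : pred I) :
  \prod_i (b i)%:R = [forall i, b i]%:R :> R.
Proof.
case: forallP => [b1|nb]; first by rewrite big1 // => i _; rewrite b1.
case/forallPn: (introN forallP nb) => i /negPf bi.
by rewrite (bigD1 i) //= bi mul0r.
Qed.

(** The condition x >= r - i splits into x >= r and the equalities x = r - k for 1 <= k <= i. *)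
Lemma sum_threshold (R : comNzRingType) (x : int) i : (i <= r)%N ->
  \sum_(k < i.+1) (if k == 0%N :> nat then (r%:Z <= x)%R else x == (r - k)%:Z)%:R =
  ((r - i)%:Z <= x)%R%:R :> R.
Proof.
elim: i => [_|i IHi lt_ir]; first by rewrite big_ord1 subn0.
rewrite big_ord_recr /= IHi 1?ltnW // -natrD; congr (_%:R).
by case: (boolP ((r - i)%:Z <= x)); case: eqP; case: (boolP ((r - i.+1)%:Z <= x)); lia.
Qed.

(* Subtracting consecutive rows turns thresholds into equalities, except in the
   row of the largest threshold, where the value is forced by the sum. *)
Lemma row_alternantE (R : comNzRingType) l nu :
  \sum_i nu i 0 = \sum_(i < r.+1) row_rho l i ->
  \sum_(s : 'S_r.+1) (-1) ^+ s * [forall i, nu (s i) 0%R == row_rho l i]%:R =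
  \sum_(s : 'S_r.+1) (-1) ^+ s * [forall i : 'I_r.+1, ((r - i)%:Z <= nu (s i) 0)%R]%:R
  :> R.
Proof.
move=> sum_nu.
(* The two alternating sums are det P and det Q, and Q = L P with L unitriangular. *)
pose P : 'M[R]_r.+1 := \matrix_(i, j)
  (if i == 0%N :> nat then (r%:Z <= nu j 0)%R else nu j 0%R == (r - i)%:Z)%:R.
pose Q : 'M[R]_r.+1 := \matrix_(i, j) ((r - i)%:Z <= nu j 0)%R%:R.
pose L : 'M[R]_r.+1 := \matrix_(i, k) (k <= i)%:R.
have QE : Q = L *m P.
  apply/matrixP => i j; rewrite !mxE -(@sum_threshold R (nu j 0) i) -1?ltnS //.
  rewrite (big_ord_widen r.+1
    (fun k => (if k == 0%N then (r%:Z <= nu j 0)%R else nu j 0%R == (r - k)%:Z)%:R)) //.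
  rewrite big_mkcond; apply: eq_bigr => k _; rewrite !mxE ltnS.
  by case: leqP; rewrite ?mul1r ?mul0r.
have detL : \det L = 1.
  rewrite det_trig; last by apply/is_trig_mxP => i j ij; rewrite mxE leqNgt ij.
  by rewrite big1 // => i _; rewrite mxE leqnn.
transitivity (\det P).
  apply: eq_bigr => s _; congr (_ * _).
  under eq_bigr do rewrite mxE.
  rewrite prodr_indicator; congr ((nat_of_bool _)%:R).
  apply/forallP/forallP => h i.
    rewrite (eqP (h i)) /row_rho.
    by case: eqP => [i0|_]; rewrite ?addr0 // i0 subn0; lia.
  have hn k : k != ord0 -> nu (s k) 0 = row_rho l k.
    move=> k0; have := h k; rewrite /row_rho.
    by rewrite -val_eqE /= in k0; rewrite (negPf k0) addr0 => /eqP.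
  have [->|/hn ->//] := eqVneq i ord0.
  move: sum_nu; rewrite (reindex_inj (@perm_inj _ s)) /= (bigD1 ord0) //=.
  rewrite [in X in _ = X](bigD1 ord0) //=.
  by rewrite (eq_bigr _ hn) => /addIr ->.
have -> : \det P = \det Q by rewrite QE det_mulmx detL mul1r.
apply: eq_bigr => s _; congr (_ * _).
by under eq_bigr do rewrite mxE; rewrite prodr_indicator.
Qed.

(** An integer representative of rho, exceeding its standard coordinates by the constant r/2. *)
Definition rho_vec : 'cV[int]_r.+1 := \col_i (r - i)%:Z.

(** The thresholds r - i <= nu (s i) say that nu - r (1, ..., 1) + sum_j j e_(s j) is nonnegative,
    so [denominator_formula] applies to [nneg_ind]. *)
Lemma row_alternant_denominator l nu :
  \sum_i nu i 0 = \sum_(i < r.+1) row_rho l i ->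
  \sum_(s : 'S_r.+1) (-1) ^+ s * [forall i, nu (s i) 0%R == row_rho l i]%:R =
  shift_eval (alphaZ (r := r)) (@nneg_ind r) (nu - rho_vec)
    (denominator r {poly int}).
Proof.
move=> /row_alternantE ->.
have -> : nu - rho_vec =
    nu - const_mx r%:Z + \sum_(j < r.+1) evec r j *+ j.
  rewrite -addrA; congr (_ + _); apply/colP => i; rewrite !mxE summxE.
  rewrite (bigD1 i) //= mulmxnE mxE eqxx big1 => [|j].
    by have := ltn_ord i; rewrite addr0; lia.
  by move=> /negPf ji; rewrite mulmxnE mxE (inj_eq val_inj) eq_sym ji mul0rn.
rewrite -denominator_formula; apply: eq_bigr => s _; congr (_ * _).
rewrite /nneg_ind; congr ((nat_of_bool _)%:R).
have E i : (nu - const_mx r%:Z + \sum_(j < r.+1) evec r (s j) *+ j) (s i) 0 =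
    nu (s i) 0 - r%:Z + i%:Z.
  rewrite !mxE summxE (bigD1 i) //= mulmxnE mxE eqxx big1 => [|j].
    by lia.
  move=> /negPf ji.
  by rewrite mulmxnE mxE (inj_eq val_inj) (inj_eq perm_inj) eq_sym ji mul0rn.
apply/forallP/forallP => h i.
  by rewrite -(permKV s i) E; have := h ((s^-1)%g i); have := ltn_ord ((s^-1)%g i); lia.
by have := h (s i); rewrite E; have := ltn_ord i; lia.
Qed.
End SingleRowAlternant.

(** * The Weyl group as a symmetric group *)

Section WeylGroup.
Variable r : nat.

(** Sends alpha_k to e_k - e_(k+1); [partial_sum_mx] is a left inverse. *)
Definition iota_mx : 'M[rat]_(r.+1, r) :=
  \matrix_(i, k) ((i == k :> nat)%:R - (i == k.+1 :> nat)%:R).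

Definition partial_sum_mx : 'M[rat]_(r, r.+1) := \matrix_(k, i) (i <= k)%N%:R.

Lemma sum_delta (R : pzRingType) n (F : nat -> R) k :
  \sum_(i < n) (i == k :> nat)%:R * F i = (k < n)%N%:R * F k.
Proof.
case: ltnP => [lt_kn|le_nk].
  rewrite (bigD1 (Ordinal lt_kn)) //= eqxx big1 ?addr0 // => i.
  by rewrite -val_eqE /= => /negPf ->; rewrite mul0r.
rewrite mul0r big1 // => i _; have := ltn_ord i.
by case: eqP => [->|_]; rewrite ?mul0r // ltnNge le_nk.
Qed.

Lemma partial_sumK : partial_sum_mx *m iota_mx = 1%:M.
Proof.
apply/matrixP => k j; rewrite !mxE.
under eq_bigr do rewrite !mxE mulrBr ![(_ <= _)%:R * _]mulrC.
rewrite sumrB (sum_delta _ (fun i => (i <= k)%N%:R)).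
rewrite (sum_delta _ (fun i => (i <= k)%N%:R)) !ltnS ltn_ord ltnW // !mul1r.
by rewrite -val_eqE /=; case: ltngtP => _; rewrite ?subrr ?subr0.
Qed.

Lemma iota_inj n : injective (mulmx iota_mx : 'M[rat]_(r, n) -> 'M_(r.+1, n)).
Proof.
by move=> x y /(congr1 (mulmx partial_sum_mx)); rewrite !mulmxA partial_sumK !mul1mx.
Qed.

(** The two lifts have the values i and i + 1. *)
Definition adj_tperm (i : 'I_r) : 'S_r.+1 := tperm (lift ord_max i) (lift ord0 i).

(** Here d x y is coordinate x of e_y - e_(y+1); swapping coordinates i and i + 1 acts on it as s_i
    does. *)
Lemma cartan_swap (i j k : nat) :
  let d x y : rat := (x == y)%:R - (x == y.+1)%:R in
  d (if k == i then i.+1 else if k == i.+1 then i else k) j =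
  d k j - d k i *
    (if i == j then 2 else if (i.+1 == j) || (j.+1 == i) then -1 else 0).
Proof.
move=> d; rewrite /d.
case: (k =P i) => ?; [|case: (k =P i.+1) => ?];
  by repeat (case: eqP => ? /=; try (exfalso; lia)); ring.
Qed.

Lemma iota_simple_refl i :
  iota_mx *m simple_refl i = perm_mx (adj_tperm i) *m iota_mx.
Proof.
rewrite -row_permE; apply/matrixP => k j; rewrite !mxE.
under eq_bigr do rewrite !mxE mulrBr.
rewrite sumrB.
have -> : \sum_(l < r) ((k == l :> nat)%:R - (k == l.+1 :> nat)%:R) * (l == j)%:R =
    (k == j :> nat)%:R - (k == j.+1 :> nat)%:R :> rat.
  rewrite (bigD1 j) //= eqxx mulr1 big1 ?addr0 // => l /negPf ->.
  by rewrite mulr0.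
have -> : \sum_(l < r) ((k == l :> nat)%:R - (k == l.+1 :> nat)%:R) *
      ((l == i)%:R * cartan i j) =
    ((k == i :> nat)%:R - (k == i.+1 :> nat)%:R) * cartan i j :> rat.
  rewrite (bigD1 i) //= eqxx mul1r big1 ?addr0 // => l /negPf ->.
  by rewrite mul0r mulr0.
have -> : adj_tperm i k =
    (if k == i :> nat then i.+1 else if k == i.+1 :> nat then i : nat else k) :> nat.
  rewrite /adj_tperm; case: tpermP => [->|->|]; rewrite ?lift_max ?lift0 ?eqxx //.
    by rewrite gtn_eqF.
  by move=> /eqP; rewrite -(inj_eq (@ord_inj _)) lift_max => /negPf -> /eqP;
     rewrite -(inj_eq (@ord_inj _)) lift0 => /negPf ->.
by rewrite cartan_swap /cartan -val_eqE.
Qed.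

Definition word_perm (w : seq 'I_r) : 'S_r.+1 := (\prod_(i <- w) adj_tperm i)%g.

Lemma iota_word w : iota_mx *m word_mx w = perm_mx (word_perm w) *m iota_mx.
Proof.
rewrite /word_mx /word_perm; elim: w => [|i w IHw].
  by rewrite !big_nil mulmx1 perm_mx1 mul1mx.
by rewrite !big_cons mulmxA iota_simple_refl -mulmxA IHw mulmxA perm_mxM.
Qed.

Lemma odd_word_perm w : odd_perm (word_perm w) = odd (size w).
Proof.
rewrite /word_perm; elim: w => [|i w IHw]; first by rewrite big_nil odd_perm1.
rewrite big_cons odd_mul_tperm IHw /= -val_eqE /=.
by rewrite /bump leqNgt ltn_ord add0n add1n ltn_eqF.
Qed.

(** The transpositions (0 y) generate the symmetric group, and adjacent ones produce each of them by
    induction on y. *)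
Lemma word_permP s : exists w, word_perm w = s.
Proof.
have : s \in <<[set tperm ord0 y | y in 'I_r.+1]>>%g by rewrite gen_tperm finset.in_setT.
case/gen_prodgP => n [c cA ->].
apply: (big_ind (fun s => exists w, word_perm w = s)) => [|_ _ [w <-] [w' <-]|i _].
- by exists [::]; rewrite /word_perm big_nil.
- by exists (w ++ w'); rewrite /word_perm big_cat.
have /imsetP[y _ ->] := cA i.
case: y => y; elim: y => [|y IHy] lt_yr.
  have -> : Ordinal lt_yr = ord0 by apply: val_inj.
  by exists [::]; rewrite /word_perm big_nil tperm1.
pose k : 'I_r := Ordinal (lt_yr : (y < r)%N).
have kl : lift ord0 k = Ordinal lt_yr by apply: val_inj.
have km : lift ord_max k = Ordinal (ltnW lt_yr) by apply: val_inj; exact: lift_max.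
case: (posnP y) => [y0|y_gt0].
  exists [:: k]; rewrite /word_perm big_seq1 /adj_tperm kl km.
  by congr tperm; apply: val_inj.
have [w Ew] := IHy (ltnW lt_yr).
(* The transposition (0 y+1) is the conjugate of (0 y) by (y y+1). *)
exists (k :: rcons w k).
rewrite /word_perm big_cons -cats1 big_cat big_seq1 /= -/(word_perm w) Ew.
rewrite -[X in (X * _)%g]tpermV -conjgE /adj_tperm tpermJ kl km tpermL.
by rewrite tpermD // -val_eqE /= ?gtn_eqF // -lt0n.
Qed.

Definition weyl_mx (s : 'S_r.+1) : 'M[rat]_r :=
  partial_sum_mx *m perm_mx s *m iota_mx.

Lemma weyl_mx_word w : weyl_mx (word_perm w) = word_mx w.
Proof. by rewrite /weyl_mx -mulmxA -iota_word mulmxA partial_sumK mul1mx. Qed.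

Lemma iota_weyl_mx s : iota_mx *m weyl_mx s = perm_mx s *m iota_mx.
Proof. by have [w <-] := word_permP s; rewrite weyl_mx_word iota_word. Qed.

Lemma weyl_mx_inj : injective weyl_mx.
Proof.
move=> s t /(congr1 (mulmx iota_mx)); rewrite !iota_weyl_mx -!row_permE => st.
apply/permP => i; apply: val_inj; move/matrixP/(_ i): st => st.
wlog lt_st : s t st / (s i < t i)%N.
  by move=> H; case: (ltngtP (s i) (t i)) => // lt_ij; [|symmetry]; apply: H => // k;
     rewrite st.
(* In column s i of [iota_mx], row s i has the entry 1, while the lower row t i has 0 or -1. *)
have lt_sr : (s i < r)%N by have := ltn_ord (t i); lia.
have := st (Ordinal lt_sr); rewrite !mxE /= eqxx (ltn_eqF (ltnSn _)) (gtn_eqF lt_st).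
by case: eqP.
Qed.

Lemma weylE : @weyl r = [set weyl_mx s | s in [set: 'S_r.+1]]%classic.
Proof.
apply/seteqP; split=> [_ [w _ <-]|_ [s _ <-]] /=.
  by exists (word_perm w) => //; exact: weyl_mx_word.
by have [w <-] := word_permP s; exists w => //; rewrite weyl_mx_word.
Qed.

(** Every word for s has the parity of s, in particular a shortest one. *)
Lemma sign_len_weyl_mx (R : pzRingType) s :
  (-1) ^+ len (weyl_mx s) = (-1) ^+ s :> R.
Proof.
rewrite /len; case: pselect => [h|[]]; last first.
  have [w <-] := word_permP s; exists (size w); apply/existsP.
  by exists (in_tuple w); rewrite weyl_mx_word.
case: ex_minnP => n /existsP[w /eqP Ew] _.
rewrite -signr_odd -{1}(size_tuple w) -odd_word_perm.
by congr ((-1) ^+ nat_of_bool (odd_perm _)); apply: weyl_mx_inj; rewrite weyl_mx_word.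
Qed.

Lemma mult_q_perm (lambda mu : weight r) :
  mult_q lambda mu = \sum_(s : 'S_r.+1) (-1) ^+ s *
    kostant_q (weyl_mx s *m (lambda + rho r) - (mu + rho r)).
Proof.
rewrite /mult_q weylE fsbig_image; last by move=> s t _ _ /weyl_mx_inj.
rewrite (@fsbig_fwiden _ _ _ _ (index_enum 'S_r.+1)) ?index_enum_uniq //.
- by apply: eq_bigr => s _; rewrite sign_len_weyl_mx.
- by move=> s _ /=; rewrite mem_index_enum.
- by move=> s [_]; case.
Qed.
End WeylGroup.

(** * Bounded partitions *)

Section KostantBound.
Variable r : nat.

Definition height (x : weight r) : rat := \sum_k x k 0.

Lemma root_weightE (b : pos_root r) k :
  root_weight b k 0 = ((val b).1 <= k <= (val b).2)%N%:R.
Proof.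
rewrite /root_weight summxE; case: (boolP ((val b).1 <= k <= (val b).2)%N) => h.
  by rewrite (bigD1 k) //= mxE !eqxx big1 ?addr0 // => j /andP[_];
     rewrite mxE eq_sym => /negPf ->.
rewrite big1 // => j hj; rewrite mxE andbT; case: eqP => // kj.
by rewrite kj hj in h.
Qed.

(** Every positive root has height at least 1. *)
Lemma le_sum_height (g : pos_root r -> nat) :
  (\sum_b g b)%N%:R <= height (\sum_b root_weight b *+ g b).
Proof.
have -> : height (\sum_b root_weight b *+ g b) =
    \sum_b height (root_weight b) *+ g b.
  rewrite /height; under eq_bigr do rewrite summxE.
  rewrite exchange_big /=; apply: eq_bigr => b _; rewrite -[RHS]sumrMnl.
  by apply: eq_bigr => k _; rewrite mulmxnE.
rewrite natr_sum; apply: ler_sum => b _; apply: ler_wMn2r.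
rewrite /height (bigD1 (val b).1) //= root_weightE leqnn (valP b) lerDl.
by apply: sumr_ge0 => k _; rewrite root_weightE ler0n.
Qed.

Definition height_bound (xi : weight r) : nat := Num.bound (height xi).

Lemma lt_height_bound (g : pos_root r -> nat) xi :
  \sum_b root_weight b *+ g b = xi -> (\sum_b g b < height_bound xi)%N.
Proof.
move=> <-; rewrite -(ltr_nat rat); apply: le_lt_trans (le_sum_height g) _.
by apply: archi_boundP; apply: le_trans (le_sum_height g); rewrite ler0n.
Qed.

(** Multiplicities in a sum of n roots never exceed n, so raising their bound to M adds no
    solutions, and all n <= M share one index set. *)
Lemma npartitions_widen (xi : weight r) n M : (n <= M)%N ->
  npartitions xi n = (\sum_(f : {ffun pos_root r -> 'I_M.+1} |
    (\sum_b (f b : nat) == n)%N && (\sum_b root_weight b *+ f b == xi)%R) 1)%N.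
Proof.
move=> le_nM; rewrite /npartitions -sum1_card.
pose h m (f : pos_root r -> nat) : {ffun pos_root r -> 'I_m.+1} := [ffun b => inord (f b)].
have hE m f b : (f b <= m)%N -> h m f b = f b :> nat by move=> fb; rewrite ffunE inordK.
have le_f m (f : {ffun pos_root r -> 'I_m.+1}) b : (f b <= \sum_b (f b : nat))%N.
  by rewrite (bigD1 b) //= leq_addr.
rewrite (reindex_onto (fun f : {ffun pos_root r -> 'I_M.+1} => h n (fun b => f b))
  (fun f => h M (fun b => f b))) /=; last first.
  move=> f _; apply/ffunP => b; apply: val_inj => /=; rewrite hE.
    by rewrite hE // (leq_trans _ le_nM) // -ltnS.
  by rewrite hE // -ltnS // (leq_trans (ltn_ord (f b))).
apply: eq_bigl => f; rewrite inE /=.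
have same : (forall b, h n (fun b => f b) b = f b :> nat) ->
    ((\sum_b (h n (fun b => f b) b : nat) == n)%N &&
     (\sum_b root_weight b *+ h n (fun b => f b) b == xi)) =
    ((\sum_b (f b : nat) == n)%N && (\sum_b root_weight b *+ f b == xi)).
  move=> E; rewrite (eq_bigr (fun b => f b : nat)); last by move=> b _; rewrite E.
  by congr (_ && (_ == _)); apply: eq_bigr => b _; rewrite E.
apply/andP/idP => [[+ /eqP hf]|H].
  rewrite same // => b; rewrite -[in RHS]hf [RHS]hE //.
  by rewrite (leq_trans _ le_nM) // -ltnS.
have fE b : h n (fun b => f b) b = f b :> nat.
  by rewrite hE // -(eqP (andP H).1) le_f.
rewrite same //; split=> //; apply/eqP/ffunP => b; apply: val_inj.
by rewrite /= hE fE // -ltnS.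
Qed.

(** No partition of xi has more than M parts, so the grouping by number of parts can be undone. Any
    large M works, hence one M serves all Weyl group elements. *)
Lemma kostant_q_bounded (xi : weight r) M : (height_bound xi <= M)%N ->
  kostant_q xi = \sum_(f : {ffun pos_root r -> 'I_M.+1})
    (\sum_b root_weight b *+ f b == xi)%R%:R * 'X^(\sum_b f b).
Proof.
move=> leM; rewrite /kostant_q.
have np0 n : (M < n)%N -> npartitions xi n = 0%N.
  move=> lt_Mn; apply: eq_card0 => f; rewrite inE; apply/negP => /andP[/eqP fn /eqP].
  by move/lt_height_bound; rewrite fn; lia.
rewrite (@fsbigE _ _ _ _ _ (iota 0 M.+1)) ?iota_uniq //; last first.
  move=> n _; rewrite mem_iota add0n /= -leqNgt => /np0 ->.
  by rewrite scale0r.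
transitivity (\sum_(n < M.+1) ((npartitions xi n)%:Z *: 'X^n : {poly int})).
  rewrite -(big_mkord xpredT (fun n => (npartitions xi n)%:Z *: 'X^n : {poly int})).
  by rewrite /index_iota subn0; apply: eq_bigl => n; rewrite in_setT.
under eq_bigr => n _ do
  rewrite (@npartitions_widen _ n M) -1?ltnS // -natz natr_sum scaler_suml big_mkcond.
rewrite exchange_big /=; apply: eq_bigr => f _.
case: eqP => [fxi|_]; last first.
  by rewrite mul0r big1 // => n _; rewrite andbF.
have ltM : (\sum_b (f b : nat) < M.+1)%N.
  by rewrite (leq_trans (lt_height_bound fxi)) // leqW.
rewrite (bigD1 (Ordinal ltM)) //= eqxx /= scale1r mul1r [X in _ + X]big1 ?addr0 // => n.
by rewrite -val_eqE /= eq_sym => /negPf ->.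
Qed.
End KostantBound.

(** * Weights in standard coordinates *)

Section FundamentalWeights.
Variable r : nat.

(** The boundary zeros of g make the first and last coordinates fit the same difference formula. *)
Lemma iota_mulE (x : weight r) (g : nat -> rat) j :
  (forall k : 'I_r, x k 0 = g k.+1) -> g 0%N = 0 -> g r.+1 = 0 ->
  (iota_mx r *m x) j 0 = g j.+1 - g j.
Proof.
move=> xg g0 gr; rewrite mxE.
under eq_bigr do rewrite mxE xg mulrBl.
rewrite sumrB; congr (_ - _).
  under eq_bigr do rewrite eq_sym.
  rewrite (sum_delta _ (fun k => g k.+1)); case: ltnP => [_|le_rj]; first by rewrite mul1r.
  by rewrite mul0r -(_ : r = j) //; apply/eqP; rewrite eqn_leq le_rj -ltnS ltn_ord.
case: j => [[|j] lt_jr] /=; first by rewrite g0 big1 // => k _; rewrite mul0r.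
under eq_bigr do rewrite eqSS eq_sym.
by rewrite (sum_delta _ (fun k => g k.+1)) (lt_jr : (j < r)%N) mul1r.
Qed.

Lemma sum_alphaE (P : pred 'I_r) (c : 'I_r -> rat) k :
  (\sum_(j < r | P j) c j *: alpha j) k 0 = if P k then c k else 0.
Proof.
rewrite summxE big_mkcond (bigD1 k) //= big1 ?addr0 => [|j].
  by rewrite !mxE !eqxx mulr1.
by rewrite eq_sym => /negPf jk; rewrite !mxE jk mulr0 if_same.
Qed.

(** This is e_0 + ... + e_i projected onto the vectors of coordinate sum 0. *)
Lemma iota_fund_weight (i : 'I_r) j :
  (iota_mx r *m fund_weight i) j 0 = (j <= i)%N%:R - i.+1%:R / r.+1%:R.
Proof.
(* The coefficients by 1-based position t, extended by zeros at t = 0 and t = r + 1. *)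
pose g (t : nat) : rat := if (t <= i)%N then (r - i)%:R / r.+1%:R * t%:R
  else i.+1%:R / r.+1%:R * (r.+1%:R - t%:R).
have r0 : r.+1%:R != 0 :> rat by rewrite pnatr_eq0.
have ri : (r - i)%:R = r.+1%:R - i.+1%:R :> rat.
  by rewrite -natrB ?ltnS 1?ltnW // subSS.
rewrite (@iota_mulE _ g); first last.
- by rewrite /g leqNgt ltnS ltnW // subrr mulr0.
- by rewrite /g /= mulr0.
- move=> k; rewrite /fund_weight mxE [X in X + _]mxE [X in _ + X]mxE !sum_alphaE /g.
  case: ltnP => ki; rewrite ?mulr0 ?addr0 ?add0r // -subSS natrB //.
  by rewrite ltnS ltnW.
rewrite /g; case: (ltngtP j i) => [ji|ij|->].
- by rewrite ri /=; field; rewrite nat1r.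
- by rewrite /=; field; rewrite nat1r.
- by rewrite ri /=; field; rewrite nat1r.
Qed.

Lemma iota_alpha k : iota_mx r *m alpha k = map_mx intr (alphaZ k).
Proof.
apply/colP => i; rewrite !mxE (bigD1 k) //= big1 => [|j /negPf jk].
  by rewrite !mxE !eqxx mulr1 addr0 rmorphB /= !natz.
by rewrite !mxE jk mulr0.
Qed.

Lemma iota_root_weight (b : pos_root r) :
  iota_mx r *m root_weight b =
  map_mx intr (evec r (val b).1 - evec r (val b).2.+1).
Proof.
rewrite -root_mnm_wt ?(valP b) ?ltn_ord // /root_weight /mnm_wt mulmx_sumr.
rewrite [map_mx _ _]raddf_sum big_mkcond /=; apply: eq_bigr => k _.
rewrite mnmE; case: ifP => _; last by rewrite mulr0n map_mx0.
by rewrite mulr1n iota_alpha.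
Qed.

Definition weight_shift (m : 'I_r -> nat) : rat :=
  \sum_(i < r) (i.+1%:R / r.+1%:R) *+ m i.

(** The partition with [m i] columns of length i + 1. *)
Definition partition_vec (m : 'I_r -> nat) : 'cV[int]_r.+1 :=
  \col_j (\sum_(i < r | (j <= i)%N) m i)%N%:Z.

Lemma iota_sum_fund_weight (m : 'I_r -> nat) :
  iota_mx r *m (\sum_(i < r) fund_weight i *+ m i) =
  map_mx intr (partition_vec m) - const_mx (weight_shift m).
Proof.
rewrite mulmx_sumr; apply/colP => j; rewrite summxE !mxE.
rewrite -pmulrn natr_sum [X in _ = X - _]big_mkcond -sumrB; apply: eq_bigr => i _.
rewrite (raddfMn (mulmx (iota_mx r))) mulmxnE iota_fund_weight mulrnBl; congr (_ - _).
by case: ifP => _; rewrite ?mul0rn.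
Qed.
End FundamentalWeights.

(** * Multiplicities in one-row representations *)

Section RowMultiplicity.
Variable r : nat.

Lemma prod_pos_root (R : comNzRingType) (F : nat -> nat -> R) :
  \prod_(b : pos_root r) F (val b).1 (val b).2 =
  \prod_(j < r) \prod_(i < j.+1) F i j.
Proof.
transitivity (\prod_(p : 'I_r * 'I_r | (p.1 <= p.2)%N) F p.1 p.2).
  rewrite [RHS](reindex_omap (val : pos_root r -> _) insub) /=; last first.
    by move=> p p12; rewrite insubT.
  by apply: eq_bigl => b; rewrite valK eqxx (valP b).
rewrite -(pair_big_dep xpredT (fun i j : 'I_r => (i <= j)%N) (fun i j : 'I_r => F i j)).
rewrite (exchange_big_dep predT) //=; apply: eq_bigr => j _.
by rewrite (big_ord_widen r (fun i => F i j)).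
Qed.

Lemma sum_leq_ord (j : nat) : (\sum_(i < r) (j <= i) = r - j)%N.
Proof.
rewrite -[RHS]muln1 -sum_nat_const_nat (big_nat_widenl _ 0%N) // big_mkord.
by rewrite [RHS]big_mkcond; apply: eq_bigr => i _ /=; case: leqP.
Qed.

Lemma partition_vec1 : partition_vec (fun _ : 'I_r => 1%N) = rho_vec r.
Proof.
apply/colP => j; rewrite !mxE; congr (_%:Z).
by rewrite -(sum_leq_ord j) big_mkcond; apply: eq_bigr => i _; case: ifP.
Qed.

Lemma iota_rho : iota_mx r *m rho r =
  map_mx intr (rho_vec r) - const_mx (weight_shift (fun _ : 'I_r => 1%N)).
Proof.
by rewrite -partition_vec1 -iota_sum_fund_weight.
Qed.

Definition rootZ (b : pos_root r) := evec r (val b).1 - evec r (val b).2.+1.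

Lemma sum_rootZ b n : \sum_i (rootZ b *+ n) i 0 = 0.
Proof.
have := @sum_raise r 0 (widen_ord (leqnSn r) (val b).1) (lift ord0 (val b).2) n.
by rewrite add0r => ->; rewrite big1 // => i _; rewrite mxE.
Qed.

(** In standard coordinates s permutes the entries. As l is the size of the partition, lambda and mu
    carry the same constant shift l/(r+1), which cancels and leaves an equation of integers. *)
Lemma partition_conditionE (hr : (0 < r)%N) l (m : 'I_r -> nat) (s : 'S_r.+1)
    (f : pos_root r -> nat) : l = (\sum_(i < r) i.+1 * m i)%N ->
  (\sum_b root_weight b *+ f b ==
    weyl_mx s *m (fund_weight (Ordinal hr) *+ l + rho r) -
    (\sum_(i < r) fund_weight i *+ m i + rho r)) =
  [forall i, (partition_vec m + rho_vec r + \sum_b rootZ b *+ f b) i 0%R ==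
    row_rho r l (s i)].
Proof.
move=> hl; rewrite -(inj_eq (@iota_inj r 1)) mulmxBr mulmxA iota_weyl_mx -mulmxA.
rewrite -row_permE !mulmxDr iota_sum_fund_weight iota_rho mulmx_sumr.
have -> : \sum_b iota_mx r *m (root_weight b *+ f b) =
    map_mx intr (\sum_b rootZ b *+ f b).
  rewrite [map_mx _ _]raddf_sum; apply: eq_bigr => b _ /=.
  by rewrite (raddfMn (mulmx (iota_mx r))) raddfMn /= iota_root_weight.
have shiftE : (l%:R / r.+1%:R : rat) = weight_shift m.
  rewrite hl natr_sum mulr_suml; apply: eq_bigr => i _.
  by rewrite natrM mulrAC mulr_natr.
have entry i : (row_perm s (iota_mx r *m (fund_weight (Ordinal hr) *+ l) +
      (map_mx intr (rho_vec r) - const_mx (weight_shift (fun _ : 'I_r => 1%N)))) -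
    (map_mx intr (partition_vec m) - const_mx (weight_shift m) +
     (map_mx intr (rho_vec r) - const_mx (weight_shift (fun _ : 'I_r => 1%N))))) i 0 =
    (row_rho r l (s i) - (partition_vec m + rho_vec r) i 0)%:~R.
  rewrite (raddfMn (mulmx (iota_mx r))) -shiftE.
  rewrite !mxE mulmxnE iota_fund_weight /row_rho leqn0 !rmorphB !rmorphD /=.
  rewrite mulrnBl -[1 / _ *+ l]mulr_natl mul1r.
  have -> : (s i == 0%N :> nat)%:R *+ l = (if s i == 0%N :> nat then l else 0%N)%:~R :> rat.
    by case: eqP; rewrite -pmulrn ?mul0rn.
  by ring.
set B := partition_vec m + rho_vec r in entry *.
apply/eqP/forallP => [/colP E i|E]; last first.
  apply/colP => i; rewrite entry -(eqP (E i)) mxE.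
  by congr (_%:~R); rewrite [(B + _) i 0]mxE [RHS]addrC addKr.
have := E i; rewrite entry mxE => /intr_inj Ei.
by rewrite mxE Ei addrC subrK.
Qed.

Lemma sum_partition_vec (m : 'I_r -> nat) :
  \sum_j partition_vec m j 0 = (\sum_(i < r) i.+1 * m i)%N%:Z.
Proof.
under eq_bigr do rewrite mxE.
rewrite -[in RHS]natz natr_sum.
under eq_bigr do rewrite -natz natr_sum big_mkcond.
rewrite exchange_big /=; apply: eq_bigr => i _.
rewrite -big_mkcond /= -natr_sum; congr (_%:R).
rewrite (eq_bigl (fun j : 'I_r.+1 => (j < i.+1)%N)) //.
by rewrite -(big_ord_widen r.+1 (fun=> m i)) ?leqW // sum_nat_const card_ord.
Qed.

(** A column of length i + 1 occupies rows 0, ..., i, whose weights add up to binom(i + 1, 2). *)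
Lemma wdeg_partition_vec (m : 'I_r -> nat) :
  wdeg val (partition_vec m) = (\sum_(i < r) m i * 'C(i.+1, 2))%N.
Proof.
rewrite /wdeg; under eq_bigr do rewrite mxE /= big_distrr /= big_mkcond.
rewrite exchange_big /=; apply: eq_bigr => i _.
rewrite -big_mkcond /= (eq_bigl (fun j : 'I_r.+1 => (j < i.+1)%N)) //.
rewrite -(big_ord_widen r.+1 (fun j => j * m i)%N) ?leqW // -big_distrl mulnC.
by rewrite /= -(big_mkord xpredT id) -bin2_sum.
Qed.

Theorem mult_q_row (hr : (0 < r)%N) l (m : 'I_r -> nat) :
  l = (\sum_(i < r) i.+1 * m i)%N ->
  mult_q (fund_weight (Ordinal hr) *+ l) (\sum_(i < r) fund_weight i *+ m i) =
  'X^(\sum_(i < r) m i * 'C(i.+1, 2)).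
Proof.
move=> hl; rewrite mult_q_perm.
set mu := \sum_(i < r) fund_weight i *+ m i.
set lambda := _ *+ l.
pose xi s := weyl_mx s *m (lambda + rho r) - (mu + rho r).
(* One bound for all s, and at least l, so that M + 1 exceeds the coordinate sum of the
   partition. *)
pose M := (l + \max_s height_bound (xi s))%N.
have leM s : (height_bound (xi s) <= M)%N.
  by rewrite (leq_trans _ (leq_addl _ _)) // leq_bigmax.
pose nu (f : {ffun pos_root r -> 'I_M.+1}) :=
  partition_vec m + rho_vec r + \sum_b rootZ b *+ f b.
under eq_bigr => s _ do rewrite (kostant_q_bounded (leM s)) mulr_sumr.
rewrite exchange_big /=.
(* For fixed multiplicities f, the sum over s is the alternant of a one-row weight. *)
transitivity (\sum_(f : {ffun pos_root r -> 'I_M.+1}) 'X^(\sum_b f b) *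
    shift_eval (alphaZ (r := r)) (@nneg_ind r) (nu f - rho_vec r) (denominator r {poly int})).
  apply: eq_bigr => f _; rewrite -(@row_alternant_denominator _ l); last first.
    rewrite /nu; under eq_bigr do rewrite 2!mxE summxE.
    rewrite !big_split /= sum_partition_vec -hl exchange_big [X in _ + X]big1 ?addr0 /=.
      rewrite addrC; congr (_ + _).
        by apply: eq_bigr => i _; rewrite mxE.
      by rewrite big_ord_recl /= big1 ?addr0.
    by move=> b _; apply: sum_rootZ.
  (* The alternant permutes the entries of nu, the partition condition those of [row_rho]; inversion
     exchanges the two and keeps the sign. *)
  rewrite mulr_sumr (reindex_inj invg_inj) /=; apply: eq_bigr => s _.
  rewrite odd_permV partition_conditionE // mulrA mulrC; congr (_ * (_ * _)).
  congr ((nat_of_bool _)%:R); apply/forallP/forallP => E i.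
    by have := E (s i); rewrite permK.
  by have := E ((s^-1)%g i); rewrite permKV.
rewrite -wdeg_partition_vec -(@shift_eval_roots _ M.+1); first last.
- by rewrite sum_partition_vec -hl ltz_nat ltnS leq_addr.
- by apply/forallP => i; rewrite mxE.
(* Expanding the product of truncated geometric series, f records the exponent chosen for each
   root. *)
transitivity (shift_eval (alphaZ (r := r)) (@nneg_ind r) (partition_vec m)
  (denominator r {poly int} * \prod_(b : pos_root r)
     \sum_(k < M.+1) 'X^k *: root_poly r {poly int} (val b).1 (val b).2 ^+ k)).
  rewrite bigA_distr_bigA mulr_sumr shift_eval_sum; apply: eq_bigr => f _.
  rewrite scaler_prod -expr_sum -scalerAr shift_evalZ; congr (_ * _).
  have -> : \prod_(b : pos_root r) root_poly r {poly int} (val b).1 (val b).2 ^+ f b =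
      'X_[\sum_(b : pos_root r) root_mnm r (val b).1 (val b).2 *+ f b].
    rewrite (big_morph (mpolyX {poly int}) (@mpolyXD _ _) (@mpolyX0 _ _)).
    by apply: eq_bigr => b _; rewrite /root_poly mpolyXn.
  rewrite shift_evalMX mnm_wt_sum /nu addrAC addrK.
  congr (shift_eval _ _ (_ + _) _); apply: eq_bigr => b _.
  by rewrite mnm_wtMn root_mnm_wt // (valP b) ltn_ord.
rewrite /denominator (prod_pos_root (fun i j =>
  \sum_(k < M.+1) 'X^k *: root_poly r {poly int} i j ^+ k)) -big_split /=.
by congr shift_eval; apply: eq_bigr => j _; rewrite -big_split.
Qed.
End RowMultiplicity.

(** * Specialization to few nonzero m_j *)

Lemma entry_gt r (m : 'I_r -> nat) k : (r < k)%N -> entry m k = 0%N.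
Proof. by move=> lt_rk; rewrite /entry big1 // => i /eqP; have := ltn_ord i; lia. Qed.

Lemma entry_ord r (m : 'I_r -> nat) (i : 'I_r) : entry m i.+1 = m i.
Proof. by rewrite /entry (eq_bigl (pred1 i)) ?big_pred1_eq. Qed.

(** The coefficients are binom(2, 2) = 1, binom(3, 2) = 3 and binom(4, 2) = 6, while binom(1, 2) =
    0. *)
Lemma sum_binom_entry r (m : 'I_r -> nat) :
  (forall j : nat, (5 <= j <= r)%N -> entry m j = 0%N) ->
  (\sum_(i < r) m i * 'C(i.+1, 2) =
   entry m 2 + 3 * entry m 3 + 6 * entry m 4)%N.
Proof.
move=> m5; rewrite /entry !big_distrr /=.
rewrite [X in (X + _ + _)%N]big_mkcond [X in (_ + X + _)%N]big_mkcond.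
rewrite [X in (_ + _ + X)%N]big_mkcond -!big_split /=; apply: eq_bigr => i _.
have := entry_ord m i; have := m5 i.+1; have := ltn_ord i.
case: (nat_of_ord i) => [|[|[|[|k]]]] ltir; rewrite ?ltir.
- by rewrite muln0.
- by rewrite muln1 !addn0.
- by rewrite addn0 mulnC.
- by rewrite mulnC.
by move=> -> // <-.
Qed.

Theorem theorem1p4 (r : nat) (hr : (0 < r)%N) (l : nat) (m : 'I_r -> nat)
    (hl : l = (\sum_(i < r) i.+1 * m i)%N) :
  let lambda : weight r := fund_weight (Ordinal hr) *+ l in
  let mu : weight r := \sum_(i < r) fund_weight i *+ m i in
  [/\ (forall j : nat, (3 <= j <= r)%N -> entry m j = 0%N) ->
        mult_q lambda mu = 'X^(entry m 2),
      (forall j : nat, (4 <= j <= r)%N -> entry m j = 0%N) ->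
        entry m 3 <> 0%N ->
        mult_q lambda mu = 'X^(entry m 2 + 3 * entry m 3)
    & (forall j : nat, (5 <= j <= r)%N -> entry m j = 0%N) ->
        entry m 4 <> 0%N ->
        (entry m 4 = 1%N ->
           mult_q lambda mu = 'X^(entry m 2 + 3 * entry m 3 + 6)) /\
        ((2 <= entry m 4)%N ->
           mult_q lambda mu =
             'X^(entry m 2 + 3 * entry m 3 + 6 * entry m 4))].
Proof.
(* Entries beyond r are 0 by convention, so vanishing for b <= j <= r extends to all j >= b. *)
have entry0 b j : (forall j, (b <= j <= r)%N -> entry m j = 0%N) -> (b <= j)%N ->
    entry m j = 0%N.
  move=> mb le_bj; have [le_jr|] := leqP j r; last exact: entry_gt.
  by rewrite mb ?le_bj.
move=> lambda mu; rewrite /lambda /mu mult_q_row //.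
split=> [m0|m0 _|m0 _]; rewrite sum_binom_entry;
  try by move=> j /andP[? _]; apply: entry0 m0 _; lia.
- by rewrite (entry0 _ 3 m0) // (entry0 _ 4 m0) // !muln0 !addn0.
- by rewrite (entry0 _ 4 m0) // muln0 addn0.
- by split=> [->|_].
Qed.
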